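(* For all integers $N\ge 1$ and $n\ge 0$, $$\sum_{\substack{i_1+i_2+i_3=n\\ i_1,i_2,i_3\ge 0}}\binom{n}{i_1,i_2,i_3}\widehat E_{N,i_1}\widehat E_{N,i_2}\widehat E_{N,i_3}=\sum_{m=0}^n\sum_{k=0}^m\binom{n}{m}\binom{m}{k}\frac{(4N-m+2)(2N-k+1)}{2(2N+1)^2}\widehat E_{N,k}\,E_{N,n-m}\,E_{N,m-k}.$$
   Context: $\binom{n}{i_1,i_2,i_3}=\frac{n!}{i_1!i_2!i_3!}$. For an integer $N\ge 0$, the hypergeometric Euler numbers $E_{N,n}$ are defined by $\dfrac{1}{\sum_{m\ge 0}\frac{(2N)!}{(2N+2m)!}t^{2m}}=\sum_{n=0}^\infty E_{N,n}\frac{t^n}{n!}$ (the denominator equals ${}_1F_2(1;N+1,\tfrac{2N+1}{2};\tfrac{t^2}{4})$), and the complementary hypergeometric Euler numbers $\widehat E_{N,n}$ are defined by $$\frac{t^{2N+1}/(2N+1)!}{\sinh t-\sum_{m=0}^{N-1}t^{2m+1}/(2m+1)!}=\sum_{n=0}^\infty\widehat E_{N,n}\frac{t^n}{n!},$$ equivalently $1/\sum_{m\ge0}\frac{(2N+1)!}{(2N+2m+1)!}t^{2m}=\sum_n\widehat E_{N,n}t^n/n!$. *)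

(* Defs.v *)
From mathcomp Require Import all_boot all_order all_algebra.

Set Implicit Arguments.
Unset Strict Implicit.
Unset Printing Implicit Defensive.

Import GRing.Theory Num.Theory.
Local Open Scope ring_scope.

(* A formal power series sum_n a_n t^n is the function n |-> a_n. *)
Definition fps (F : fieldType) := nat -> F.

Definition fps_mul (F : fieldType) (a b : fps F) : fps F :=
  fun n => \sum_(i < n.+1) a i * b (n - i)%N.

(* The first n coefficients of 1/a, from
   b_0 = 1 / a_0 and b_n = - (1 / a_0) sum_(1 <= j <= n) a_j b_(n-j). *)
Fixpoint fps_inv_seq (F : fieldType) (a : fps F) (n : nat) : seq F :=
  if n is n'.+1 then
    let s := fps_inv_seq a n' in
    rcons s ((a 0)^-1 *
             ((n' == 0)%:R - \sum_(j < n') a j.+1 * s`_(n' - j.+1)))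
  else [::].

(* Meaningful when a_0 != 0 (see fps_mulV). *)
Definition fps_inv (F : fieldType) (a : fps F) : fps F :=
  fun n => (fps_inv_seq a n.+1)`_n.

Definition fps_shift (F : fieldType) (v : nat) (a : fps F) : fps F :=
  fun n => a (n + v)%N.

(* The quotient a / b when b has order exactly v and t^v divides a: the common
   factor t^v is cancelled before inverting (see fps_divK). *)
Definition fps_div (F : fieldType) (v : nat) (a b : fps F) : fps F :=
  fps_mul (fps_shift v a) (fps_inv (fps_shift v b)).

Definition fps_monom (F : fieldType) (c : F) (d : nat) : fps F :=
  fun n => if n == d then c else 0.

Definition fps_sinh : fps rat := fun n => if odd n then (n`!)%:R^-1 else 0.

(* sum_(m >= 0) (2N)! / (2N + 2m)! t^(2m) *)
Definition hyp_euler_den (N : nat) : fps rat :=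
  fun n => if odd n then 0 else ((2 * N)`!)%:R / ((2 * N + n)`!)%:R.

(* sinh t - sum_(m < N) t^(2m+1) / (2m+1)! *)
Definition comp_hyp_euler_den (N : nat) : fps rat :=
  fun n => fps_sinh n
    - \sum_(m < N) fps_monom (((2 * m + 1)`!)%:R^-1) (2 * m + 1) n.

Definition comp_hyp_euler_num (N : nat) : fps rat :=
  fps_monom (((2 * N + 1)`!)%:R^-1) (2 * N + 1).

(* E_{N,n}; the factor n! is due to the exponential generating function. *)
Definition hyp_euler (N n : nat) : rat :=
  (n`!)%:R * fps_inv (hyp_euler_den N) n.

(* \hat E_{N,n}; the denominator has order 2N + 1. *)
Definition comp_hyp_euler (N n : nat) : rat :=
  (n`!)%:R *
  fps_div (2 * N + 1) (comp_hyp_euler_num N) (comp_hyp_euler_den N) n.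

Definition trinomial (n i j k : nat) : rat :=
  (n`!)%:R / ((i`!)%:R * (j`!)%:R * (k`!)%:R).

Lemma size_fps_inv_seq (F : fieldType) (a : fps F) n :
  size (fps_inv_seq a n) = n.
Proof. by elim: n => //= n IH; rewrite size_rcons IH. Qed.

Lemma nth_fps_inv_seq (F : fieldType) (a : fps F) n i :
  (i < n)%N -> (fps_inv_seq a n)`_i = fps_inv a i.
Proof.
elim: n => // n IH; rewrite ltnS leq_eqVlt => /orP[/eqP->//|lt_in].
by rewrite /= nth_rcons size_fps_inv_seq lt_in IH.
Qed.

Lemma fps_mulV (F : fieldType) (a : fps F) :
  a 0 != 0 -> fps_mul a (fps_inv a) =1 fps_monom 1 0.
Proof.
move=> a0 n; rewrite /fps_mul big_ord_recl /= subn0 {1}/fps_inv /=.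
rewrite nth_rcons size_fps_inv_seq ltnn eqxx mulVKf //.
under eq_bigr => j _ do rewrite nth_fps_inv_seq ?rev_ord_proof //.
by rewrite subrK /fps_monom; case: eqP.
Qed.

Lemma fps_mul_poly (F : fieldType) (a b : fps F) n k : (k < n)%N ->
  fps_mul a b k = (\poly_(i < n) a i * \poly_(i < n) b i)`_k.
Proof.
move=> lt_kn; rewrite coefM; apply: eq_bigr => i _.
by rewrite !coef_poly (leq_ltn_trans _ lt_kn) ?leq_ord //
           (leq_ltn_trans _ lt_kn) ?leq_subr.
Qed.

Lemma eq_fps_mul (F : fieldType) (a a' b b' : fps F) :
  a =1 a' -> b =1 b' -> fps_mul a b =1 fps_mul a' b'.
Proof. by move=> ea eb n; apply: eq_bigr => i _; rewrite ea eb. Qed.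

Lemma fps_mulC (F : fieldType) (a b : fps F) : fps_mul a b =1 fps_mul b a.
Proof. by move=> n; rewrite !(fps_mul_poly _ _ (ltnSn n)) mulrC. Qed.

Lemma fps_mulA (F : fieldType) (a b c : fps F) :
  fps_mul a (fps_mul b c) =1 fps_mul (fps_mul a b) c.
Proof.
move=> n; transitivity
  ((\poly_(i < n.+1) a i * (\poly_(i < n.+1) b i * \poly_(i < n.+1) c i))`_n).
  rewrite coefM; apply: eq_bigr => i _.
  by rewrite coef_poly ltn_ord -fps_mul_poly ?ltnS ?leq_subr.
rewrite mulrA coefM; apply: eq_bigr => i _.
by rewrite coef_poly ltnS leq_subr -fps_mul_poly.
Qed.

Lemma fps_monomM (F : fieldType) (c : F) (a : fps F) n :
  fps_mul (fps_monom c 0) a n = c * a n.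
Proof.
rewrite /fps_mul big_ord_recl /fps_monom /= subn0 big1 ?addr0 // => i _.
by rewrite mul0r.
Qed.

Lemma fps_inv_unique (F : fieldType) (a b : fps F) :
  a 0 != 0 -> fps_mul a b =1 fps_monom 1 0 -> b =1 fps_inv a.
Proof.
move=> a0 ab n; rewrite -[RHS]mul1r -fps_monomM.
rewrite -(eq_fps_mul ab (frefl _)) (eq_fps_mul (fps_mulC a b) (frefl _)).
rewrite -fps_mulA (eq_fps_mul (frefl b) (fps_mulV a0)) fps_mulC.
by rewrite fps_monomM mul1r.
Qed.

(* The defining equation b * (a / b) = a. *)
Lemma fps_divK (F : fieldType) (v : nat) (a b : fps F) :
  b v != 0 -> (forall n, (n < v)%N -> b n = 0) ->
  (forall n, (n < v)%N -> a n = 0) ->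
  fps_mul b (fps_div v a b) =1 a.
Proof.
move=> bv b0 a0 n; case: (ltnP n v) => [lt_nv|/subnK <-].
  rewrite a0 // /fps_mul big1 // => i _.
  by rewrite b0 ?mul0r // (leq_ltn_trans _ lt_nv) ?leq_ord.
move: (n - v)%N => p; rewrite /fps_mul.
rewrite -(big_mkord xpredT (fun i => b i * fps_div v a b (p + v - i)%N)).
rewrite (@big_cat_nat _ _ _ v) //=; last by rewrite leqW ?leq_addl.
rewrite big_nat big1 ?add0r => [|i /= /b0->]; last by rewrite mul0r.
rewrite -{1}[v]add0n -addSn big_addn addnK big_mkord.
transitivity (fps_mul (fps_shift v b) (fps_div v a b) p).
  by apply: eq_bigr => i _; rewrite subnDr.
rewrite /fps_div fps_mulC -fps_mulA.
rewrite (@eq_fps_mul _ _ (fps_shift v a) _ (fps_monom 1 0)) //; first last.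
  by move=> k; rewrite fps_mulC fps_mulV // /fps_shift add0n.
by rewrite fps_mulC fps_monomM mul1r.
Qed.

Lemma comp_hyp_euler_denE (N n : nat) :
  comp_hyp_euler_den N n =
  if odd n && (2 * N < n)%N then (n`!)%:R^-1 else 0.
Proof.
rewrite /comp_hyp_euler_den /fps_sinh /fps_monom.
case: (boolP (odd n)) => [on|en] /=; last first.
  rewrite big1 ?subr0 // => m _; case: eqP => // en'.
  by rewrite en' oddD mul2n odd_double in en.
have def_n : n = (2 * n./2 + 1)%N by rewrite -{1}[n]odd_double_half on mul2n addnC.
have eqn (m : nat) : (n == 2 * m + 1)%N = (m == n./2).
  by rewrite {1}def_n eqn_add2r eqn_pmul2l // eq_sym.
case: ltnP => [lt_Nn|le_nN].
  rewrite big1 ?subr0 // => m _; case: eqP => // en; move: lt_Nn.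
  by rewrite en addn1 ltnS leq_pmul2l // leqNgt ltn_ord.
have lt : (n./2 < N)%N by rewrite def_n addn1 ltn_pmul2l in le_nN.
rewrite (bigD1 (Ordinal lt)) //= -def_n eqxx big1 ?addr0 ?subrr // => m.
by rewrite eqn -val_eqE /= => /negPf->.
Qed.

Lemma comp_hyp_euler_gf (N : nat) :
  fps_mul (comp_hyp_euler_den N)
    (fps_div (2 * N + 1) (comp_hyp_euler_num N) (comp_hyp_euler_den N))
  =1 comp_hyp_euler_num N.
Proof.
apply: fps_divK => [|n|n]; rewrite ?comp_hyp_euler_denE.
- rewrite addn1 ltnSn /= mul2n odd_double /= invr_eq0 pnatr_eq0 -lt0n.
  exact: fact_gt0.
- by rewrite addn1 ltnS ltnNge => ->; rewrite andbF.
- by rewrite /comp_hyp_euler_num /fps_monom => /ltn_eqF->.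
Qed.

(* The equivalent form 1 / sum_(m >= 0) (2N+1)! / (2N+2m+1)! t^(2m) of the
   generating function. *)
Lemma comp_hyp_eulerE (N n : nat) :
  comp_hyp_euler N n = (n`!)%:R *
    fps_inv (fun k => if odd k then 0
                      else ((2 * N + 1)`!)%:R / ((2 * N + k + 1)`!)%:R) n.
Proof.
rewrite /comp_hyp_euler; congr (_ * _); set h := fun k : nat => _.
have f0 (k : nat) : (k`!)%:R != 0 :> rat by rewrite pnatr_eq0 -lt0n fact_gt0.
apply: fps_inv_unique; first by rewrite /h /= addn0 divff ?oner_eq0.
pose c : rat := ((2 * N + 1)`!)%:R.
have hE : h =1 fps_mul (fps_monom c 0)
                 (fps_shift (2 * N + 1) (comp_hyp_euler_den N)).
  move=> k; rewrite fps_monomM /fps_shift comp_hyp_euler_denE /h.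
  have -> : (2 * N < k + (2 * N + 1))%N by rewrite addnA addn1 ltnS leq_addl.
  have -> : (k + (2 * N + 1) = 2 * N + k + 1)%N by rewrite addnA (addnC k).
  rewrite mul2n 2!oddD odd_double addbT andbT /c mul2n.
  by case: (odd k); rewrite ?mulr0.
have d0 : fps_shift (2 * N + 1) (comp_hyp_euler_den N) 0 != 0.
  rewrite /fps_shift add0n comp_hyp_euler_denE addn1 ltnSn /= mul2n.
  by rewrite odd_double /= invr_eq0.
have nE : fps_shift (2 * N + 1) (comp_hyp_euler_num N) =1 fps_monom c^-1 0.
  move=> k; rewrite /fps_shift /comp_hyp_euler_num /fps_monom.
  by rewrite -{2}[(2 * N + 1)%N]add0n eqn_add2r.
move=> k; rewrite (eq_fps_mul hE (frefl _)) -fps_mulA fps_monomM.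
rewrite /fps_div (eq_fps_mul (frefl _) (eq_fps_mul nE (frefl _))).
rewrite (eq_fps_mul (frefl _) (fps_mulC _ _)) fps_mulA.
rewrite (eq_fps_mul (fps_mulV d0) (frefl _)) fps_monomM mul1r.
by rewrite /fps_monom; case: eqP; rewrite ?mulr0 ?divff ?mulfV ?f0.
Qed.

(* Main.v *)
(* Let A and B be the denominators with 1/A = sum E_{N,n} t^n/n! and
   1/B = sum \hat E_{N,n} t^n/n!, put c = 2N+1, and let D_c = c - t d/dt, so that
   D_(c+d) (f g) = (D_c f) g + f (D_d g).  Since (t^c B)' = c t^(c-1) A, we have
   D_(-c) B = - c A; applying D_0 to B (1/B) = 1 gives D_c (1/B) = c A (1/B)^2,
   that is (1/A) D_c (1/B) = c (1/B)^2.  Applying D_(2c) gives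
   D_(2c) ((1/A) D_c (1/B)) = 2 c (1/B) D_c (1/B), and multiplying by 1/A yields
   2 c^2 (1/B)^3.  The right-hand side of the theorem is n! times the n-th
   coefficient of
   (1/A) D_(2c) ((1/A) D_c (1/B)) / (2 c^2). *)
Require Import Defs.
From mathcomp Require Import all_boot all_order all_algebra.
From mathcomp Require Import ring.

Set Implicit Arguments.
Unset Strict Implicit.
Unset Printing Implicit Defensive.

Import GRing.Theory Num.Theory.
Local Open Scope ring_scope.

(** This is [c - t d/dt]: [t d/dt] multiplies the coefficient of [t^n] by [n]. *)
Definition fps_euler_op (F : fieldType) (c : F) (a : fps F) : fps F :=
  fun n => (c - n%:R) * a n.

Lemma fps_mulZr (F : fieldType) (c : F) (a b : fps F) n :
  fps_mul a (fun k => c * b k) n = c * fps_mul a b n.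
Proof. by rewrite /fps_mul mulr_sumr; apply: eq_bigr => i _; rewrite mulrCA. Qed.

Lemma fps_mulCA (F : fieldType) (a b c : fps F) :
  fps_mul a (fps_mul b c) =1 fps_mul b (fps_mul a c).
Proof.
move=> n; rewrite !fps_mulA.
exact: (eq_fps_mul (fps_mulC a b) (frefl c)).
Qed.

Lemma fps_mulKV (F : fieldType) (a b : fps F) : a 0 != 0 ->
  fps_mul (fps_inv a) (fps_mul a b) =1 b.
Proof.
move=> a0 n; rewrite fps_mulCA fps_mulA.
by rewrite (eq_fps_mul (fps_mulV a0) (frefl b)) fps_monomM mul1r.
Qed.

(** On each term [a i * b (n - i)] the weight splits as [c + d - n = (c - i) + (d - (n - i))]. *)
Lemma fps_euler_opM (F : fieldType) (c d : F) (a b : fps F) n :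
  fps_euler_op (c + d) (fps_mul a b) n =
  fps_mul (fps_euler_op c a) b n + fps_mul a (fps_euler_op d b) n.
Proof.
rewrite /fps_euler_op /fps_mul mulr_sumr -big_split /=.
apply: eq_bigr => i _; have le_in : (i <= n)%N by rewrite -ltnS.
by rewrite -{1}(subnKC le_in) natrD; ring.
Qed.

(** The last hypothesis is [(t^c b)' = c t^(c-1) a] read on coefficients. *)
Lemma fps_euler_op_mul_inv (F : fieldType) (c : F) (a b : fps F) :
  a 0 != 0 -> b 0 != 0 -> (forall n, (c + n%:R) * b n = c * a n) ->
  fps_mul (fps_inv a) (fps_euler_op c (fps_inv b)) =1
  (fun n => c * fps_mul (fps_inv b) (fps_inv b) n).
Proof.
move=> a0 b0 ab n; set e := fps_inv a; set h := fps_inv b.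
have Db : fps_euler_op (- c) b =1 (fun k => (- c) * a k).
  by move=> k; rewrite /fps_euler_op -opprD !mulNr ab.
have bDh : fps_mul b (fps_euler_op c h) =1 (fun k => c * fps_mul h a k).
  (* The weights [- c] and [c] add up to 0, and [- t d/dt] kills the constant series [b * h = 1]. *)
  move=> k; have := fps_euler_opM (- c) c b h k.
  rewrite addNr {1}/fps_euler_op (fps_mulV b0) /fps_monom.
  rewrite (eq_fps_mul Db (frefl h)) fps_mulC fps_mulZr.
  have -> : (0 - k%:R) * (if k == 0 then 1 else 0) = 0 :> F.
    by case: eqP => [->|_]; rewrite ?subrr ?mul0r ?mulr0.
  by move/esym/eqP; rewrite addrC addr_eq0 mulNr opprK => /eqP.
(* Insert [h * b = 1], so that [bDh] applies; the factor [a] it produces cancels against [e]. *)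
rewrite -(fps_mulKV (fps_mul e (fps_euler_op c h)) b0) -/h.
rewrite (eq_fps_mul (frefl h) (fps_mulCA b e _)).
rewrite (eq_fps_mul (frefl h) (eq_fps_mul (frefl e) bDh)).
rewrite (eq_fps_mul (frefl h) (fps_mulZr c e _)) fps_mulZr; congr (_ * _).
rewrite (eq_fps_mul (frefl h) (eq_fps_mul (frefl e) (fps_mulC h a))).
exact: (eq_fps_mul (frefl h) (fps_mulKV h a0)).
Qed.

Lemma fps_inv_cube (F : fieldType) (c : F) (a b : fps F) :
  a 0 != 0 -> b 0 != 0 -> (forall n, (c + n%:R) * b n = c * a n) ->
  fps_mul (fps_inv a) (fps_euler_op (c + c)
    (fps_mul (fps_inv a) (fps_euler_op c (fps_inv b)))) =1
  (fun n => 2 * c ^+ 2 * fps_mul (fps_inv b) (fps_mul (fps_inv b) (fps_inv b)) n).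
Proof.
move=> a0 b0 ab n; set e := fps_inv a; set h := fps_inv b.
have ehc := fps_euler_op_mul_inv a0 b0 ab; rewrite -/e -/h in ehc.
have Dhh : fps_euler_op (c + c) (fps_mul e (fps_euler_op c h)) =1
    (fun k => 2 * c * fps_mul h (fps_euler_op c h) k).
  move=> k; rewrite {1}/fps_euler_op ehc mulrCA -/(fps_euler_op _ _ _).
  by rewrite fps_euler_opM (fps_mulC _ h); ring.
rewrite (eq_fps_mul (frefl e) Dhh) fps_mulZr fps_mulCA.
by rewrite (eq_fps_mul (frefl h) ehc) fps_mulZr; ring.
Qed.

Lemma fps_mul3E (F : fieldType) (a b c : fps F) n :
  fps_mul a (fps_mul b c) n =
  \sum_(i < n.+1) \sum_(j < n.+1) \sum_(k < n.+1 | (i + j + k == n)%N)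
    a i * b j * c k.
Proof.
apply: eq_bigr => i _; have le_in : (i <= n)%N by rewrite -ltnS.
rewrite /fps_mul mulr_sumr.
(* Letting [j] run up to [n] turns [j <= n - i] into a guard: within it [k = n - i - j] is the only
   index, beyond it there is none. *)
rewrite (big_ord_widen n.+1 (fun j => a i * (b j * c (n - i - j)%N))) ?ltnS ?leq_subr //.
rewrite big_mkcond; apply: eq_bigr => j _.
rewrite ltnS leq_subRL //; case: leqP => [le_ij|lt_ij]; last first.
  rewrite big1 // => k /eqP def_n.
  by move: (leq_addr k (i + j)); rewrite def_n leqNgt lt_ij.
have lt_k : (n - (i + j) < n.+1)%N by rewrite ltnS leq_subr.
rewrite (big_pred1 (Ordinal lt_k)) /= ?mulrA ?subnDA // => k /=.
by rewrite -(inj_eq val_inj) /= -[X in _ == X](subnKC le_ij) eqn_add2l.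
Qed.

Theorem theorem7 (N n : nat) (hN : (1 <= N)%N) :
  \sum_(i1 < n.+1) \sum_(i2 < n.+1) \sum_(i3 < n.+1 | (i1 + i2 + i3 == n)%N)
     trinomial n i1 i2 i3
     * comp_hyp_euler N i1 * comp_hyp_euler N i2 * comp_hyp_euler N i3
  = \sum_(m < n.+1) \sum_(k < m.+1)
      ('C(n, m))%:R * ('C(m, k))%:R
      * ((4 * N%:R - m%:R + 2) * (2 * N%:R - k%:R + 1)
         / (2 * (2 * N%:R + 1) ^+ 2))
      * comp_hyp_euler N k * hyp_euler N (n - m) * hyp_euler N (m - k)
  :> rat.
Proof.
pose a : fps rat := hyp_euler_den N.
pose b : fps rat := fun k => if odd k then 0
                      else ((2 * N + 1)`!)%:R / ((2 * N + k + 1)`!)%:R.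
pose c : rat := 2 * N%:R + 1.
have f0 (k : nat) : (k`!)%:R != 0 :> rat by rewrite pnatr_eq0 -lt0n fact_gt0.
have cE : c = (2 * N).+1%:R by rewrite -natr1 natrM.
have c0 : c != 0 by rewrite cE pnatr_eq0.
have a0 : a 0 != 0 by rewrite /a /hyp_euler_den /= addn0 divff ?oner_eq0.
have b0 : b 0 != 0 by rewrite /b /= addn0 divff ?oner_eq0.
(* For even [k], the factor [c + k = 2N + 1 + k] cancels the top factor of [(2N + k + 1)!], and
   [(2N + 1)! = c (2N)!]. *)
have ab k : (c + k%:R) * b k = c * a k.
  rewrite /a /b /hyp_euler_den; case: (odd k); first by rewrite !mulr0.
  rewrite !addn1 !factS !natrM -cE -addSn natrD -cE.
  have ck : c + k%:R != 0 by rewrite cE -natrD addSn pnatr_eq0.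
  by field; rewrite f0 ck.
set h := fps_inv b; set e := fps_inv a.
transitivity ((n`!)%:R * fps_mul h (fps_mul h h) n).
  rewrite fps_mul3E mulr_sumr; apply: eq_bigr => i _.
  rewrite mulr_sumr; apply: eq_bigr => j _.
  rewrite mulr_sumr; apply: eq_bigr => k _.
  rewrite !comp_hyp_eulerE -/b -/h /trinomial.
  by field; rewrite !f0.
have -> : fps_mul h (fps_mul h h) n =
    (2 * c ^+ 2)^-1 * fps_mul e (fps_euler_op (c + c) (fps_mul e (fps_euler_op c h))) n.
  by rewrite fps_inv_cube // mulKf // mulf_neq0 ?expf_neq0.
(* Moving each [e] to the right makes [m] the index under [D_(2c)] and [k] that of [h], giving the
   weights [4N + 2 - m] and [2N + 1 - k]. *)
rewrite mulrA (fps_mulC e) mulr_sumr; apply: eq_bigr => m _.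
rewrite {1}/fps_euler_op (fps_mulC e) /fps_mul !(mulr_sumr, mulr_suml).
apply: eq_bigr => k _; rewrite !comp_hyp_eulerE -/b -/h /hyp_euler -/a -/e.
have le_mn : (m <= n)%N by rewrite -ltnS.
have le_km : (k <= m)%N by rewrite -ltnS.
(* Splitting [n!] and then [m!] yields the two binomials and the factorials that turn coefficients
   of [h] and [e] into Euler numbers. *)
rewrite -(bin_fact le_mn) -(bin_fact le_km) !natrM /fps_euler_op /c.
by field; rewrite -/c c0.
Qed.
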